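(* Let $k\ge 1$ be an integer, let $a<b$ be real numbers, and let $f_1,\dots,f_k$ be continuous real-valued functions on the interval $[a,b]$. Let $$ I= \int_{a<x_1<\cdots <x_k<b} \det\left(f_i(x_j)\right)_{1\le i,j\le k}\,dx_1\cdots dx_k, $$ and for $1\le i,j\le k$ let $$ I_{ij}=\int_{a<x<y<b}\left( f_i(x)f_j(y)-f_j(x)f_i(y)\right)dx\, dy, \qquad I_i=\int_{a<x<b}f_i(x)\, dx. $$ If $k$ is even, then $I$ is the Pfaffian of the $k\times k$ skew-symmetric matrix $(I_{ij})_{1\le i,j\le k}$. If $k$ is odd, then $I$ is the Pfaffian of the $(k+1)\times(k+1)$ skew-symmetric matrix $(I_{ij})_{0\le i,j\le k}$ obtained by augmenting $(I_{ij})_{1\le i,j\le k}$ with a zeroth row and a zeroth column defined by $I_{00}=0$ and $I_{0i}=-I_{i0}=I_i$ for $1\le i\le k$.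
   Context: For an even positive integer $m$ and an $m\times m$ skew-symmetric matrix $S$ with rows and columns indexed by $1,\dots,m$, the Pfaffian of $S$ is $$ \operatorname{Pf}(S)=\sum_{\pi} \operatorname{sg}(\pi)\, S_{\pi(1),\pi(2)}S_{\pi(3),\pi(4)}\cdots S_{\pi(m-1),\pi(m)}, $$ where $\operatorname{sg}(\pi)$ is the sign of $\pi$ and the sum is over all permutations $\pi$ of $\{1,\dots,m\}$ satisfying $\pi(1)<\pi(2)$, $\pi(3)<\pi(4)$, $\ldots$, $\pi(m-1)<\pi(m)$ and $\pi(1)<\pi(3)<\cdots<\pi(m-1)$. For a matrix whose rows and columns are indexed by $0,1,\dots,k$ (with $k$ odd), the Pfaffian is defined in the same way after relabelling the indices $0,1,\dots,k$ in increasing order as $1,\dots,k+1$. *)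

(* Defs.v *)
From HB Require Import structures.
From mathcomp Require Import all_boot all_order all_algebra all_fingroup.
From mathcomp Require Import all_classical all_reals all_analysis.

Set Implicit Arguments.
Unset Strict Implicit.
Unset Printing Implicit Defensive.
Import Order.TTheory GRing.Theory Num.Theory.
Import numFieldNormedType.Exports.

Local Open Scope classical_set_scope.
Local Open Scope ring_scope.

(* Positions are 0-based: the i-th factor of a Pfaffian term uses the positions
   pair_fst i = 2i and pair_snd i = 2i+1, for 0 <= i < m/2. *)
Lemma pair_fst_subproof m (i : 'I_m./2) : (i.*2 < m)%N.
Proof. by rewrite ltnW// -gtn_half_double. Qed.

Lemma pair_snd_subproof m (i : 'I_m./2) : (i.*2.+1 < m)%N.
Proof. by rewrite -gtn_half_double. Qed.

Definition pair_fst m (i : 'I_m./2) : 'I_m := Ordinal (pair_fst_subproof i).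
Definition pair_snd m (i : 'I_m./2) : 'I_m := Ordinal (pair_snd_subproof i).

(* In 1-based notation: s(1) < s(2), s(3) < s(4), ..., s(m-1) < s(m) and
   s(1) < s(3) < ... < s(m-1). *)
Definition pfaffian_perm m (s : 'S_m) : bool :=
  [forall i : 'I_m./2, (s (pair_fst i) < s (pair_snd i))%N] &&
  [forall i : 'I_m./2, forall j : 'I_m./2,
     (i < j)%N ==> (s (pair_fst i) < s (pair_fst j))%N].

(* Meaningful only for m even and S skew-symmetric. *)
Definition Pf (K : comPzRingType) m (S : 'M[K]_m) : K :=
  \sum_(s : 'S_m | pfaffian_perm s)
    (-1) ^+ s * \prod_(i < m./2) S (s (pair_fst i)) (s (pair_snd i)).

(* Stated as a lemma because canonical inference on [m1 \x m2] picks the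
   library's instance for probabilities. *)
Lemma product_sigma_finite d1 d2 (T1 : measurableType d1)
    (T2 : measurableType d2) (R : realType)
    (m1 : {sigma_finite_measure set T1 -> \bar R})
    (m2 : {sigma_finite_measure set T2 -> \bar R}) :
  sigma_finite setT (m1 \x m2)%E.
Proof.
have /sigma_finiteP[F [TF ndF Foo]] := sigma_finiteT m1.
have /sigma_finiteP[G [TG ndG Goo]] := sigma_finiteT m2.
exists (fun n => F n `*` G n).
  rewrite -setXTT TF TG predeqE => -[x y]; split.
    move=> [/= [n _ Fnx] [k _ Gky]]; exists (maxn n k) => //; split.
    - by move: x Fnx; exact/subsetPset/ndF/leq_maxl.
    - by move: y Gky; exact/subsetPset/ndG/leq_maxr.
  by move=> [n _ []/= ? ?]; split; exists n.
move=> k; have [? ?] := Foo k; have [? ?] := Goo k.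
split; first exact: measurableX.
by rewrite product_measure1E// lte_mul_pinfty// ge0_fin_numE.
Qed.

Section TupleLebesgue.
Local Open Scope ereal_scope.
Context {R : realType}.
Local Notation T := (measurableTypeR R).
Local Notation mu := (@lebesgue_measure R).

Definition cons_pair n (p : T * n.-tuple T) : n.+1.-tuple T :=
  [tuple of p.1 :: p.2].

Lemma measurable_cons_pair n : measurable_fun [set: T * n.-tuple T] (@cons_pair n).
Proof. exact: measurable_cons. Qed.

Definition uncons_pair n (x : n.+1.-tuple T) : T * n.-tuple T :=
  (thead x, [tuple of behead x]).

Lemma measurable_uncons_pair n : measurable_fun [set: n.+1.-tuple T] (@uncons_pair n).
Proof.
apply/measurable_fun_pair; first exact: measurable_tnth.
exact: measurable_behead.
Qed.

Lemma cons_pairK n : cancel (@cons_pair n) (@uncons_pair n).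
Proof. by move=> [x t]; congr pair; apply: val_inj. Qed.

Section Cons.
Variables (n : nat) (nu : {sigma_finite_measure set (n.-tuple T) -> \bar R}).

Let mcons : measurable_fun [set: T * n.-tuple T] (@cons_pair n).
Proof. exact: measurable_cons_pair. Qed.

Definition cons_measure : set (n.+1.-tuple T) -> \bar R :=
  pushforward (mu \x nu) (@cons_pair n).

Let cons_measure0 : cons_measure set0 = 0.
Proof. rewrite /cons_measure; exact: measure0. Qed.

Let cons_measure_ge0 A : 0 <= cons_measure A.
Proof. rewrite /cons_measure; exact: measure_ge0. Qed.

Let cons_measure_sigma_additive : semi_sigma_additive cons_measure.
Proof. rewrite /cons_measure; exact: measure_semi_sigma_additive. Qed.

HB.instance Definition _ := isMeasure.Build _ _ _ cons_measure
  cons_measure0 cons_measure_ge0 cons_measure_sigma_additive.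

Let cons_measure_sigma_finite : sigma_finite setT cons_measure.
Proof.
have [F FT Foo] : sigma_finite setT (mu \x nu).
  exact: product_sigma_finite.
exists (fun i => @uncons_pair n @^-1` F i).
  by rewrite -preimage_bigcup -FT preimage_setT.
move=> i; have [mF Fi] := Foo i; split.
  by rewrite -[X in measurable X]setTI; exact: measurable_uncons_pair.
rewrite /cons_measure /pushforward -comp_preimage.
by rewrite (_ : _ \o _ = id)//; apply/funext => p; exact: cons_pairK.
Qed.

HB.instance Definition _ := Measure_isSigmaFinite.Build _ _ _ cons_measure
  cons_measure_sigma_finite.

End Cons.

(* n-dimensional Lebesgue measure (on the Borel sets), as the n-fold product of
   the one-dimensional one transported along R * R^n = R^(n+1);
   tuple_lebesgue_box characterizes it by its values on boxes. *)
Fixpoint tuple_lebesgue n : {sigma_finite_measure set (n.-tuple T) -> \bar R} :=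
  match n with
  | 0%N => \d_([tuple])
  | m.+1 => cons_measure (tuple_lebesgue m)
  end.

Lemma tuple_lebesgue_box n (A : 'I_n -> set T) :
  (forall i, measurable (A i)) ->
  tuple_lebesgue n [set x | forall i, A i (tnth x i)] = \prod_(i < n) mu (A i).
Proof.
elim: n A => [|n IHn] A mA.
  by rewrite big_ord0/= diracE mem_set//= => -[].
rewrite big_ord_recl -IHn => [|i]; last exact: mA.
rewrite -product_measure1E; [|exact: mA|].
- rewrite /= /cons_measure /pushforward; congr (product_measure1 _ _ _).
  apply/seteqP; split => [[x t] /= xtA|[x t] /= [Ax At] i].
    split; first by have := xtA ord0; rewrite tnth0.
    by move=> i; have := xtA (lift ord0 i); rewrite tnthS.
  by case: (unliftP ord0 i) => [j|] ->; rewrite ?tnthS ?tnth0.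
- have -> : [set x : n.-tuple T | forall i, A (lift ord0 i) (tnth x i)] =
      \bigcap_(i in [set: 'I_n])
        ((fun x : n.-tuple T => tnth x i) @^-1` A (lift ord0 i)).
    by apply/seteqP; split=> x /= Ax i; [move=> _; exact: Ax|exact: (Ax i)].
  apply: fin_bigcap_measurable => [|i _]; first exact: finite_finset.
  by rewrite -[X in measurable X]setTI; exact: measurable_tnth.
Qed.

End TupleLebesgue.

Section Integrals.
Context {R : realType}.
Variables a b : R.

(* a < x_1 < ... < x_k < b *)
Definition ordered_tuples k : set (k.-tuple (measurableTypeR R)) :=
  [set x | path <%R a (rcons x b)].

Definition ordered_pairs : set (measurableTypeR R * measurableTypeR R) :=
  [set p | [/\ a < p.1, p.1 < p.2 & p.2 < b]].

Definition det_integral k (f : 'I_k -> R -> R) : R :=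
  \int[tuple_lebesgue k]_(x in @ordered_tuples k)
    \det (\matrix_(i < k, j < k) f i (tnth x j)).

Definition pair_integral (g h : R -> R) : R :=
  \int[(lebesgue_measure \x lebesgue_measure)%E]_(p in ordered_pairs)
    (g p.1 * h p.2 - h p.1 * g p.2).

Definition single_integral (g : R -> R) : R :=
  \int[lebesgue_measure]_(x in `]a, b[) g x.

Definition pair_integral_mx k (f : 'I_k -> R -> R) : 'M[R]_k :=
  \matrix_(i < k, j < k) pair_integral (f i) (f j).

(* The zeroth row and column come first: block_mx 0 (I_j) (- I_i) (I_ij). *)
Definition bordered_integral_mx k (f : 'I_k -> R -> R) : 'M[R]_(1 + k) :=
  block_mx 0 (\row_j single_integral (f j))
           (- \col_i single_integral (f i)) (pair_integral_mx f).

Lemma tr_pair_integral_mx k (f : 'I_k -> R -> R) :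
  (pair_integral_mx f)^T = - pair_integral_mx f.
Proof.
apply/matrixP => i j; rewrite !mxE /pair_integral /Rintegral.
under eq_integral do rewrite -opprB EFinN.
rewrite integralE [in RHS]integralE funeposN funenegN.
set u := integral _ _ _; set v := integral _ _ _.
have u0 : (0 <= u)%E by exact: integral_ge0.
have v0 : (0 <= v)%E by exact: integral_ge0.
by case: u v u0 v0 => [u| |] [v| |] //= _ _; rewrite ?oppr0 ?opprB.
Qed.

Lemma tr_bordered_integral_mx k (f : 'I_k -> R -> R) :
  (bordered_integral_mx f)^T = - bordered_integral_mx f.
Proof.
rewrite /bordered_integral_mx tr_block_mx opp_block_mx tr_pair_integral_mx.
by congr block_mx; apply/matrixP => i j; rewrite !mxE ?oppr0 ?opprK.
Qed.

End Integrals.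

(* Main.v *)
Require Import Defs.
From HB Require Import structures.
From mathcomp Require Import all_boot all_order all_algebra all_fingroup.
From mathcomp Require Import all_classical all_reals all_analysis.
From mathcomp Require Import measurable_realfun.
From mathcomp Require Import ring zify.

Set Implicit Arguments.
Unset Strict Implicit.
Unset Printing Implicit Defensive.
Import Order.TTheory GRing.Theory Num.Theory.
Import numFieldNormedType.Exports.

Local Open Scope classical_set_scope.
Local Open Scope ring_scope.

(** The proof lets the lower end of the domain of integration vary. For a list
    l of indices let D(l, t) be the integral of det (f_{l_i}(x_j)) over
    t < x_1 < ... < x_n < b, let I_y(t) and I_{xy}(t) be the one- and
    two-variable integrals with the same lower end t, and write X for the
    alternating sum over the ways of taking one entry y out of l, leaving a
    list l' (altsum). Integrating over x_1 last and expanding the determinant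
    along its first column (det_integral_cons) gives
      - D(l, t)' = X (f_y(t) D(l', t)),   D(l, b) = 0 for l nonempty.
    The sums that arise from expanding a Pfaffian are known in terms of D:
    - X (I_y D(l')) equals D(l) if l has odd size and 0 otherwise
      (altsum_single_integral);
    - X (I_{xy} D(l')) equals D(x :: l) if l has odd size and
      D(x :: l) - I_x D(l) otherwise (altsum_pair_integral).
    Both are proved by induction on the size of l. The two sides vanish at
    t = b, and their derivatives agree by the induction hypothesis and by the
    antisymmetry of iterated alternating sums (altsum_swap).

    It remains to expand the Pfaffian along its first row (expand_Pf). For an
    even number of functions this is X (I_{xy} Pf(l')) with l of odd size, so
    the second identity and induction give the theorem. For an odd number the
    first row of the bordered matrix holds the I_y, and the minors are
    Pfaffians of the even case, so that the first identity applies. *)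

(** * Alternating sums over deletions *)

Lemma mkseqS (T : Type) (h : nat -> T) n :
  mkseq h n.+1 = h 0%N :: mkseq (h \o bump 0) n.
Proof. by rewrite /mkseq/= (iotaDl 1 0) -map_comp. Qed.

Section AlternatingSum.
Context {T : Type} {K : comPzRingType}.
Implicit Types (phi psi : T -> seq T -> K) (l : seq T).

(** The sum over the positions j of l of (-1)^j phi(l_j, l without l_j), as
    altsum_mkseq shows. The structural recursion makes linearity and
    antisymmetry one-line inductions, free of index arithmetic. *)
Fixpoint altsum phi l : K :=
  if l is x :: l' then phi x l' - altsum (fun y l'' => phi y (x :: l'')) l'
  else 0.

Lemma eq_altsum phi psi l :
  (forall y l', (size l').+1 = size l -> phi y l' = psi y l') ->
  altsum phi l = altsum psi l.
Proof.
elim: l phi psi => //= x l IHl phi psi eq_phi; rewrite eq_phi//.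
by congr (_ - _); apply: IHl => y l' sl'; rewrite eq_phi//= sl'.
Qed.

Lemma altsumD phi psi l :
  altsum (fun y l' => phi y l' + psi y l') l = altsum phi l + altsum psi l.
Proof. by elim: l phi psi => [|x l IHl] phi psi /=; rewrite ?IHl; ring. Qed.

Lemma altsumZ c phi l : altsum (fun y l' => c * phi y l') l = c * altsum phi l.
Proof. by elim: l phi => [|x l IHl] phi /=; rewrite ?IHl; ring. Qed.

Lemma altsum0 l : altsum (fun _ _ => 0) l = 0.
Proof. by elim: l => //= x l ->; rewrite subr0. Qed.

Lemma altsumN phi l : altsum (fun y l' => - phi y l') l = - altsum phi l.
Proof.
by rewrite -mulN1r -altsumZ; apply: eq_altsum => y l' _; rewrite mulN1r.
Qed.

Lemma altsumB phi psi l :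
  altsum (fun y l' => phi y l' - psi y l') l = altsum phi l - altsum psi l.
Proof. by rewrite altsumD altsumN. Qed.

(** Taking out two entries in the other order reverses the sign: the later
    entry moves by one position once the earlier one is gone. *)
Lemma altsum_swap (chi : T -> T -> seq T -> K) l :
  altsum (fun y => altsum (chi y)) l =
  - altsum (fun y => altsum (fun z => chi z y)) l.
Proof.
elim: l chi => [|x l IHl] chi /=; first by rewrite oppr0.
by rewrite !altsumB IHl; ring.
Qed.

(** The list indexed by h has its j-th entry deleted by precomposing h with
    bump j. This is the link with the minors of matrices. *)
Lemma altsum_mkseq phi (h : nat -> T) n :
  altsum phi (mkseq h n) =
  \sum_(j < n) (-1) ^+ j * phi (h j) (mkseq (h \o bump j) n.-1).
Proof.
elim: n h phi => [|n IHn] h phi; first by rewrite big_ord0.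
rewrite mkseqS [LHS]/= IHn big_ord_recl/= expr0 mul1r -sumrN.
congr (_ + _); apply: eq_bigr => j _.
rewrite exprS mulN1r mulNr; congr (- (_ * phi _ _)).
case: n j {IHn} => [[]//|n] j /=.
rewrite [RHS]mkseqS; congr (_ :: _); apply: eq_map => i /=.
by congr h; rewrite /bump; lia.
Qed.

End AlternatingSum.

(** * Expansion of the Pfaffian along the first row *)

Section PfaffianExpansion.
Context {K : comPzRingType}.

Lemma big_lift_perm n (i j : 'I_n.+1) (P : pred 'S_n.+1) (F : 'S_n.+1 -> K) :
  \sum_(s | P s && (s i == j)) F s =
  \sum_(t : 'S_n | P (lift_perm i j t)) F (lift_perm i j t).
Proof.
(* The inverse of lift_perm i j: s with the point i and its image removed. *)
pose low (s : 'S_n.+1) k := odflt k (unlift (s i) (s (lift i k))).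
have lowK (s : 'S_n.+1) k : lift (s i) (low s k) = s (lift i k).
  have: s i != s (lift i k) by rewrite (inj_eq perm_inj) neq_lift.
  by rewrite /low => /unlift_some[k' ? ->].
have low_inj (s : 'S_n.+1) : injective (low s).
  move=> k k' /(congr1 (lift (s i))); rewrite !lowK.
  by move/perm_inj/lift_inj.
rewrite (reindex_onto (lift_perm i j) (fun s => perm (low_inj s))) => [|s].
  apply: eq_bigl => t; rewrite lift_perm_id eqxx andbT -[RHS]andbT.
  congr (_ && _); apply/eqP/permP => k; rewrite permE.
  by rewrite /low lift_perm_lift lift_perm_id liftK.
case/andP=> _ /eqP sij; apply/permP => k.
case: (unliftP i k) => [k'|] ->; last by rewrite lift_perm_id.
by rewrite lift_perm_lift permE -sij lowK.
Qed.

(** The value 0 cannot be the larger entry of a pair, and among the smaller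
    entries it comes first. For m odd it could be at the unpaired last
    position. *)
Lemma pfaffian_perm_ord0 m (s : 'S_m.+2) :
  ~~ odd m -> pfaffian_perm s -> s ord0 = ord0.
Proof.
move=> m_even /andP[/forallP lt_pair /forallP lt_fst].
pose p := (s^-1%g) ord0; have sp : s p = ord0 by rewrite permKV.
have pm : (p./2 < m.+2./2)%N by have := ltn_ord p; lia.
pose i : 'I_m.+2./2 := Ordinal pm.
have [p_odd|p_even] := boolP (odd p).
  have ps : p = pair_snd i by apply: val_inj => /=; lia.
  by have := lt_pair i; rewrite -ps sp ltn0.
have pf : p = pair_fst i by apply: val_inj => /=; lia.
have [i0|i_gt0] := posnP i.
  by rewrite -[RHS]sp; congr (s _); apply: val_inj; move: i0 => /=; lia.
have := forallP (lt_fst ord0) i.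
by rewrite -pf sp ltn0 implybF -ltnNge ltnS leqNgt i_gt0.
Qed.

Lemma ltn_lift n (h : 'I_n) (i j : 'I_n.-1) :
  (lift h i < lift h j)%N = (i < j)%N.
Proof. by rewrite /= !ltnNge leq_bump2. Qed.

Section Lift2.
Variables (m : nat) (j : 'I_m.+1).
(* The permutation that pairs 0 with lift ord0 j and follows t on the rest. *)
Let lift2 (t : 'S_m) : 'S_m.+2 := lift_perm ord0 ord0 (lift_perm ord0 j t).

Lemma pair_fst_lift (i : 'I_m./2) :
  @pair_fst m.+2 (lift ord0 i) = lift ord0 (lift ord0 (pair_fst i)).
Proof. by apply: val_inj. Qed.

Lemma pair_snd_lift (i : 'I_m./2) :
  @pair_snd m.+2 (lift ord0 i) = lift ord0 (lift ord0 (pair_snd i)).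
Proof. by apply: val_inj. Qed.

Lemma pair_fst0 : @pair_fst m.+2 ord0 = ord0.
Proof. by apply: val_inj. Qed.

Lemma pair_snd0 : @pair_snd m.+2 ord0 = lift ord0 ord0.
Proof. by apply: val_inj. Qed.

(** The conditions of lift2 t at the first pair hold because it maps 0 to 0;
    the others are those of t, as lifts preserve the order. *)
Lemma pfaffian_perm_lift2 t : pfaffian_perm (lift2 t) = pfaffian_perm t.
Proof.
rewrite /pfaffian_perm; congr (_ && _).
  apply/forallP/forallP => lt_pair i.
    have := lt_pair (lift ord0 i).
    by rewrite pair_fst_lift pair_snd_lift !lift_perm_lift !ltn_lift.
  case: (unliftP ord0 i) => [i'|] ->.
    by rewrite pair_fst_lift pair_snd_lift !lift_perm_lift !ltn_lift.
  by rewrite pair_fst0 pair_snd0 lift_perm_id !lift_perm_lift.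
apply/forallP/forallP => lt_fst i; apply/forallP => i'.
  have := forallP (lt_fst (lift ord0 i)) (lift ord0 i').
  by rewrite !pair_fst_lift !lift_perm_lift !ltn_lift.
case: (unliftP ord0 i) => [k|] ->; case: (unliftP ord0 i') => [k'|] -> //.
  have := forallP (lt_fst k) k'.
  by rewrite !pair_fst_lift !lift_perm_lift !ltn_lift.
by rewrite pair_fst0 pair_fst_lift lift_perm_id !lift_perm_lift.
Qed.

End Lift2.

(** In a Pfaffian permutation the first pair is (0, j.+1) for some j, and what
    remains is a Pfaffian permutation of the other m indices. *)
Lemma expand_Pf m (S : 'M[K]_m.+2) : ~~ odd m ->
  Pf S = \sum_(j < m.+1) (-1) ^+ j * (S ord0 (lift ord0 j) *
    Pf (\matrix_(i < m, i' < m)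
      S (lift ord0 (lift j i)) (lift ord0 (lift j i')))).
Proof.
move=> m_even; rewrite {1}/Pf.
transitivity (\sum_(s : 'S_m.+2 | pfaffian_perm s && (s ord0 == ord0))
    (-1) ^+ s * \prod_(i < m.+2./2) S (s (pair_fst i)) (s (pair_snd i))).
  apply: eq_bigl => s; apply/idP/andP => [sP|[]//].
  by rewrite (pfaffian_perm_ord0 m_even sP) eqxx.
rewrite big_lift_perm (partition_big (fun t : 'S_m.+1 => t ord0) predT)//=.
apply: eq_bigr => j _; rewrite big_lift_perm /Pf 2!big_distrr/=.
apply: eq_big => [t|t _]; first exact: pfaffian_perm_lift2.
rewrite !odd_lift_perm/= signr_addb signr_odd -!mulrA; congr (_ * _).
rewrite big_ord_recl pair_fst0 pair_snd0 !(lift_perm_id, lift_perm_lift).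
rewrite mulrCA; congr (_ * (_ * _)); apply: eq_bigr => i _.
by rewrite mxE pair_fst_lift pair_snd_lift !lift_perm_lift.
Qed.

Lemma Pf0 (S : 'M[K]_0) : Pf S = 1.
Proof.
rewrite /Pf (bigD1 1%g)/= ?odd_perm1 ?big_ord0 ?big1 ?expr0 ?mulr1 ?addr0//.
  by move=> s /andP[_ /eqP[]]; apply/permP => -[].
by apply/andP; split; apply/forallP => -[].
Qed.

End PfaffianExpansion.

(** * Primitives as functions of the lower end *)

Section DecreasingPrimitive.
Context {R : realType}.
Variables a b : R.
Hypothesis ab : a < b.
Implicit Types F G g h : R -> R.

(** The minus sign is that of the derivative of an integral in its lower end:
    single_integral_opp_primitive is the basic example. *)
Definition opp_primitive F g := {within `[a, b], continuous F} /\
  forall t, t \in `]a, b[ -> is_derive t 1 F (- g t).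

Lemma opp_primitive_cst c : opp_primitive (cst c) (cst 0).
Proof.
split => [|t _]; first exact: continuous_subspaceT (@cst_continuous _ _ c).
by rewrite oppr0; exact: is_derive_cst.
Qed.

Lemma opp_primitiveB F G g h : opp_primitive F g -> opp_primitive G h ->
  opp_primitive (fun t => F t - G t) (fun t => g t - h t).
Proof.
move=> [cF dF] [cG dG]; split => [t|t tab].
  by apply: cvgB; [exact: cF|exact: cG].
have Fd := dF _ tab; have Gd := dG _ tab.
by rewrite opprB addrC -[h t]opprK; exact: (is_deriveB Fd Gd).
Qed.

Lemma opp_primitiveM F G g h : opp_primitive F g -> opp_primitive G h ->
  opp_primitive (fun t => F t * G t) (fun t => g t * G t + F t * h t).
Proof.
move=> [cF dF] [cG dG]; split => [t|t tab].
  by apply: cvgM; [exact: cF|exact: cG].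
have Fd := dF _ tab; have Gd := dG _ tab.
apply: (is_derive_eq (is_deriveM Fd Gd)).
by rewrite /GRing.scale/=; ring.
Qed.

Lemma opp_primitive_altsum (T : Type) (Phi phi : T -> seq T -> R -> R) l :
  (forall y l', opp_primitive (Phi y l') (phi y l')) ->
  opp_primitive (fun t => altsum (fun y l' => Phi y l' t) l)
                (fun t => altsum (fun y l' => phi y l' t) l).
Proof.
elim: l Phi phi => [|x l IHl] Phi phi Pphi /=; first exact: opp_primitive_cst.
by apply: opp_primitiveB => //; exact: (IHl (fun y l' => Phi y (x :: l'))).
Qed.

Lemma opp_primitive_unique F G g h : opp_primitive F g -> opp_primitive G h ->
  {in `]a, b[, g =1 h} -> F b = G b -> {in `[a, b], F =1 G}.
Proof.
move=> PF PG gh Fb t tab; have [cH dH] := opp_primitiveB PF PG.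
have /andP[a_t t_b] : a <= t <= b by move: tab; rewrite in_itv.
have dFG x : x \in `]t, b[ -> is_derive x 1 (fun x => F x - G x) 0.
  move=> xtb; have xab : x \in `]a, b[.
    by move: xtb; rewrite !in_itv/= => /andP[tx ->]; rewrite (le_lt_trans a_t).
  by have := dH x xab; rewrite gh// subrr oppr0.
have cFG : {within `[t, b], continuous (fun x => F x - G x)}.
  by apply: continuous_subspaceW cH; apply: subset_itvr; rewrite bnd_simp.
have [c _] := MVT_segment t_b dFG cFG.
by rewrite Fb subrr mul0r sub0r => /eqP; rewrite oppr_eq0 subr_eq0 => /eqP.
Qed.

Lemma single_integral_end g : single_integral b b g = 0.
Proof. by rewrite /single_integral set_itvoo0 Rintegral_set0. Qed.

Lemma within_itv_integrable g : {within `[a, b], continuous g} ->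
  lebesgue_measure.-integrable `[a, b] (EFin \o g).
Proof.
move=> cg; apply: continuous_compact_integrable => //.
exact: segment_compact.
Qed.

Lemma single_integral_opp_primitive g : {within `[a, b], continuous g} ->
  opp_primitive (fun t => single_integral t b g) g.
Proof.
move=> cg; have ig := within_itv_integrable cg.
pose I t := \int[lebesgue_measure]_(x in `[a, t]) g x.
have IE t : t \in `[a, b] -> single_integral t b g = I b - I t.
  rewrite in_itv/= => /andP[a_t t_b].
  rewrite /I Rintegral_itvB ?bnd_simp// /single_integral.
  rewrite Rintegral_itv_bndo_bndc//.
  by apply: integrableS ig => //; apply: subset_itv; rewrite bnd_simp.
split.
  apply: (@subspace_eq_continuous _ _ _ (fun t => I b - I t)).
    by move=> t /=; rewrite inE => tab; rewrite [RHS]IE.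
  move=> t; apply: cvgB; first exact: cvg_cst.
  exact: parameterized_integral_continuous (ltW ab) ig t.
move=> t tab.
have [a_t t_b] : a < t /\ t < b by move: tab; rewrite in_itv => /andP.
have ct : {for t, continuous g}.
  by have /(continuous_within_itvP _ ab)[+ _ _] := cg; apply.
have [dI It] := continuous_FTC1_closed t_b ig a_t ct.
have dt : is_derive t 1 (cst (I b) - I) (- g t).
  rewrite -[- g t]add0r; apply: is_deriveB.
  by rewrite -It derive1E; exact: derivableP.
apply: near_eq_is_derive dt; near=> x; rewrite [RHS]IE//.
near: x; apply: filterS (near_in_itvoo tab) => x.
by rewrite !in_itv/= => /andP[/ltW -> /ltW ->].
Unshelve. all: by end_near. Qed.

End DecreasingPrimitive.

(** * Two identities for iterated determinant integrals *)

Section OrderedDeterminant.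
Context {R : realType} {T : Type}.
Variables (a b : R) (f : T -> R -> R).
Hypothesis ab : a < b.
Hypothesis cf : forall y, {within `[a, b], continuous (f y)}.
Implicit Types (l : seq T) (t : R).

(** The integral of det (f_{l_i}(x_j)) over t < x_1 < ... < x_n < b, defined
    by integrating over x_1 last; det_integral_iterated is the comparison with
    the multiple integral. The number n is the size of l; it is a separate
    argument because the lists with one entry deleted are not subterms of l. *)
Fixpoint ordered_det_rec n l t : R :=
  if n is n'.+1 then
    single_integral t b
      (fun s => altsum (fun y l' => f y s * ordered_det_rec n' l' s) l)
  else 1.

Definition ordered_det l := ordered_det_rec (size l) l.

Definition ordered_det_integrand l t :=
  altsum (fun y l' => f y t * ordered_det l' t) l.

Lemma ordered_detE l t : (0 < size l)%N ->
  ordered_det l t = single_integral t b (ordered_det_integrand l).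
Proof.
rewrite /ordered_det; case sl: (size l) => [//|n] _ /=.
apply: eq_Rintegral => s _; apply: eq_altsum => y l' /esym.
by rewrite sl => -[->].
Qed.

Lemma continuous_altsum (phi : T -> seq T -> R -> R) l :
  (forall y l', {within `[a, b], continuous (phi y l')}) ->
  {within `[a, b], continuous (fun t => altsum (fun y l' => phi y l' t) l)}.
Proof.
elim: l phi => [|x l IHl] phi cphi t /=; first exact: cvg_cst.
apply: cvgB; first exact: cphi.
exact: (IHl (fun y l' => phi y (x :: l'))).
Qed.

Lemma continuous_ordered_det l : {within `[a, b], continuous (ordered_det l)}.
Proof.
rewrite /ordered_det; move: (size l) => n.
elim: n l => [|n IHn] l; first by move=> t; exact: cvg_cst.
apply: (single_integral_opp_primitive ab _).1.
by apply: continuous_altsum => y l' t; apply: cvgM; [exact: cf|exact: IHn].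
Qed.

Lemma continuous_ordered_det_integrand l :
  {within `[a, b], continuous (ordered_det_integrand l)}.
Proof.
by apply: continuous_altsum => y l' t; apply: cvgM;
  [exact: cf|exact: continuous_ordered_det].
Qed.

Lemma ordered_det_end l : (0 < size l)%N -> ordered_det l b = 0.
Proof. by move=> ?; rewrite ordered_detE// single_integral_end. Qed.

Lemma ordered_det_opp_primitive l :
  opp_primitive a b (ordered_det l) (ordered_det_integrand l).
Proof.
have [l0|l_gt0] := posnP (size l).
  by move/size0nil: l0 => ->; exact: opp_primitive_cst.
rewrite (_ : ordered_det l =
    fun t => single_integral t b (ordered_det_integrand l)).
  exact/single_integral_opp_primitive/continuous_ordered_det_integrand.
by apply/funext => t; exact: ordered_detE.
Qed.

Let I y t := single_integral t b (f y).
(* The integral over t < s < u < b of f x s * f y u - f y s * f x u. *)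
Let II x y t := single_integral t b (fun s => f x s * I y s - f y s * I x s).

Let I_opp_primitive y : opp_primitive a b (I y) (f y).
Proof. exact: single_integral_opp_primitive. Qed.

Let II_opp_primitive x y :
  opp_primitive a b (II x y) (fun s => f x s * I y s - f y s * I x s).
Proof.
apply: single_integral_opp_primitive => // t.
by apply: cvgB; apply: cvgM; try exact: cf; exact: (I_opp_primitive _).1.
Qed.

(** Differentiating term by term gives the integrand of
    ordered_det l and, after altsum_swap, minus the alternating sum of f z
    times the left-hand side for l'. The sizes of l and l' have opposite
    parities, so by induction the second part cancels the first one exactly
    when l has even size. *)
Lemma altsum_single_integral l t : t \in `[a, b] ->
  altsum (fun y l' => I y t * ordered_det l' t) l =
  (odd (size l))%:R * ordered_det l t.
Proof.
have [n] := ubnP (size l); elim: n => // n IHn in l t * => ln tab.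
have := opp_primitive_unique
  (opp_primitive_altsum l (fun y l' =>
     opp_primitiveM (I_opp_primitive y) (ordered_det_opp_primitive l')))
  (opp_primitiveM (opp_primitive_cst a b (odd (size l))%:R)
     (ordered_det_opp_primitive l)).
apply=> //; last first.
  (* At t = b both sides vanish; for l empty because its size is even. *)
  rewrite (eq_altsum (psi := fun _ _ => 0)) ?altsum0 => [|y l' _].
    have [/size0nil->|l0] := posnP (size l); first by rewrite mul0r.
    by rewrite ordered_det_end// mulr0.
  by rewrite /I single_integral_end mul0r.
move=> s sab; have sab' : s \in `[a, b] by apply: subset_itv_oo_cc.
rewrite mul0r add0r altsumD.
under [X in _ + X]eq_altsum do rewrite /ordered_det_integrand -altsumZ.
rewrite altsum_swap.
rewrite [X in _ - X](eq_altsum (psi := fun z l' =>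
    (~~ odd (size l))%:R * (f z s * ordered_det l' s))) => [|z l' sl'].
  rewrite altsumZ -/(ordered_det_integrand l s).
  by case: odd => /=; ring.
under eq_altsum do rewrite mulrCA.
by rewrite altsumZ IHn -?sl' ?negbK 1?mulrCA// -ltnS sl'.
Qed.

(** The derivative of the left-hand side has three parts: f x times the sum of
    altsum_single_integral, minus I x times the integrand of ordered_det l, and
    minus the alternating sum of f z times the left-hand side for l'. If l has
    odd size, the first part is f x * ordered_det l, and the correction in the
    induction hypothesis cancels the second part. If l has even size, the first
    part is absent and no correction arises from l'; the derivative of the
    product on the right-hand side accounts for both. *)
Lemma altsum_pair_integral x l t : t \in `[a, b] ->
  altsum (fun y l' => II x y t * ordered_det l' t) l =
  ordered_det (x :: l) t - (~~ odd (size l))%:R * (I x t * ordered_det l t).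
Proof.
have [n] := ubnP (size l); elim: n => // n IHn in l t * => ln tab.
have := opp_primitive_unique
  (opp_primitive_altsum l (fun y l' =>
     opp_primitiveM (II_opp_primitive x y) (ordered_det_opp_primitive l')))
  (opp_primitiveB (ordered_det_opp_primitive (x :: l))
    (opp_primitiveM (opp_primitive_cst a b (~~ odd (size l))%:R)
     (opp_primitiveM (I_opp_primitive x) (ordered_det_opp_primitive l)))).
apply=> //; last first.
  rewrite (eq_altsum (psi := fun _ _ => 0)) ?altsum0 => [|y l' _].
    by rewrite ordered_det_end// /I single_integral_end mul0r mulr0 subr0.
  by rewrite /II single_integral_end mul0r.
move=> s sab; have sab' : s \in `[a, b] by apply: subset_itv_oo_cc.
rewrite mul0r add0r altsumD.
under [X in _ + X]eq_altsum do rewrite /ordered_det_integrand -altsumZ.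
rewrite altsum_swap.
rewrite (eq_altsum (psi := fun y l' => f x s * (I y s * ordered_det l' s) -
    I x s * (f y s * ordered_det l' s))) => [|y l' _]; last by ring.
rewrite altsumB !altsumZ altsum_single_integral//.
rewrite [X in _ - X](eq_altsum (psi := fun z l' =>
    f z s * ordered_det (x :: l') s -
    (odd (size l))%:R * (I x s * (f z s * ordered_det l' s)))) => [|z l' sl'].
  have -> : ordered_det_integrand (x :: l) s = f x s * ordered_det l s -
      altsum (fun z l' => f z s * ordered_det (x :: l') s) l by [].
  rewrite altsumB !altsumZ -/(ordered_det_integrand l s).
  by case: odd => /=; ring.
under eq_altsum do rewrite mulrCA.
rewrite altsumZ IHn -?sl'//=; last by rewrite -ltnS sl'.
by rewrite mulrBr !(mulrCA (f z s)).
Qed.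

(** expand_Pf takes two indices away at a time, and its first row is the left
    side of altsum_pair_integral with an odd number of remaining functions. *)
Lemma Pf_iterated_pair_integral n (h : nat -> T) t :
  ~~ odd n -> t \in `[a, b] ->
  Pf (\matrix_(i < n, j < n) II (h i) (h j) t) = ordered_det (mkseq h n) t.
Proof.
move=> n_even tab.
have [k kn] := ubnP n; elim: k => // k IHk in n h n_even kn *.
case: n n_even kn => [_ _|[//|n]]; first by rewrite Pf0.
rewrite /= negbK => n_even /ltnW kn; rewrite expand_Pf// mkseqS.
have := altsum_pair_integral (h 0%N) (mkseq (h \o bump 0) n.+1) tab.
rewrite size_mkseq [odd _]/= n_even mul0r subr0 => <-; rewrite altsum_mkseq.
apply: eq_bigr => j _; rewrite mxE -IHk//; congr (_ * (_ * Pf _)).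
by apply/matrixP => i i'; rewrite !mxE.
Qed.

(** Deleting the bordering index and one more from an odd number of functions
    leaves Pfaffians of the even case, so one expansion suffices. *)
Lemma Pf_bordered_iterated_integral n (h : nat -> T) t :
  odd n -> t \in `[a, b] ->
  Pf (block_mx 0 (\row_(j < n) I (h j) t)
        (- (\col_(i < n) I (h i) t))
        (\matrix_(i < n, j < n) II (h i) (h j) t) : 'M[R]_(1 + n)) =
  ordered_det (mkseq h n) t.
Proof.
case: n => // n /= n_even tab; set S := block_mx _ _ _ _; rewrite expand_Pf//.
have S_row0 j : S ord0 (lift ord0 j) = I (h j) t.
  transitivity (S (lshift n.+1 ord0) (rshift 1 j)).
    by congr (S _ _); exact: val_inj.
  by rewrite block_mxEur mxE.
have S_lift i j : S (lift ord0 i) (lift ord0 j) = II (h i) (h j) t.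
  transitivity (S (rshift 1 i) (rshift 1 j)).
    by congr (S _ _); exact: val_inj.
  by rewrite block_mxEdr mxE.
have := altsum_single_integral (mkseq h n.+1) tab.
rewrite size_mkseq [odd _]/= n_even mul1r => <-; rewrite altsum_mkseq.
apply: eq_bigr => j _; rewrite S_row0 -Pf_iterated_pair_integral//.
congr (_ * (_ * Pf _)).
by apply/matrixP => i i'; rewrite [LHS]mxE [RHS]mxE; exact: S_lift.
Qed.

End OrderedDeterminant.

(** * Bounded measurable functions and Fubini's theorem *)

Section BoundedMeasurable.
Context d (X : measurableType d) {R : realType}.
Variable D : set X.
Implicit Types F G : X -> R.

(** On a set of finite measure these functions are integrable, and unlike
    integrable functions they are closed under products, hence under
    determinants. *)
Definition bounded_measurable F :=
  measurable_fun D F /\ exists M, forall x, D x -> `|F x| <= M.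

Lemma bounded_measurable_cst c : bounded_measurable (cst c).
Proof. by split; [exact: measurable_cst|exists `|c|]. Qed.

Lemma bounded_measurableD F G : bounded_measurable F -> bounded_measurable G ->
  bounded_measurable (fun x => F x + G x).
Proof.
move=> [mF [M FM]] [mG [N GN]]; split; first exact: measurable_funD.
exists (M + N) => x Dx; rewrite (le_trans (ler_normD _ _))// lerD//.
- exact: FM.
- exact: GN.
Qed.

Lemma bounded_measurableM F G : bounded_measurable F -> bounded_measurable G ->
  bounded_measurable (fun x => F x * G x).
Proof.
move=> [mF [M FM]] [mG [N GN]]; split; first exact: measurable_funM.
by exists (M * N) => x Dx; rewrite normrM ler_pM// ?FM// GN.
Qed.

Lemma bounded_measurableB F G : bounded_measurable F -> bounded_measurable G ->
  bounded_measurable (fun x => F x - G x).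
Proof.
move=> bF bG; under eq_fun do rewrite -mulN1r.
by apply: bounded_measurableD => //; apply: bounded_measurableM => //;
  exact: bounded_measurable_cst.
Qed.

Lemma bounded_measurable_sum I (s : seq I) (F : I -> X -> R) :
  (forall i, bounded_measurable (F i)) ->
  bounded_measurable (fun x => \sum_(i <- s) F i x).
Proof.
move=> bF; elim: s => [|i s IHs].
  by under eq_fun do rewrite big_nil; exact: bounded_measurable_cst.
by under eq_fun do rewrite big_cons; exact: bounded_measurableD.
Qed.

Lemma bounded_measurable_prod I (s : seq I) (F : I -> X -> R) :
  (forall i, bounded_measurable (F i)) ->
  bounded_measurable (fun x => \prod_(i <- s) F i x).
Proof.
move=> bF; elim: s => [|i s IHs].
  by under eq_fun do rewrite big_nil; exact: bounded_measurable_cst.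
by under eq_fun do rewrite big_cons; exact: bounded_measurableM.
Qed.

Lemma bounded_measurable_det n (A : 'I_n -> 'I_n -> X -> R) :
  (forall i j, bounded_measurable (A i j)) ->
  bounded_measurable (fun x => \det (\matrix_(i < n, j < n) A i j x)).
Proof.
move=> bA; apply: bounded_measurable_sum => s.
apply: bounded_measurableM; first exact: bounded_measurable_cst.
apply: bounded_measurable_prod => i.
by under eq_fun do rewrite mxE.
Qed.

Lemma bounded_measurable_integrable (m : {measure set X -> \bar R}) F :
  measurable D -> (m D < +oo)%E -> bounded_measurable F ->
  m.-integrable D (EFin \o F).
Proof.
move=> mD mDoo [mF [M FM]]; apply: measurable_bounded_integrable => //.
exists M; split; first exact: num_real.
by move=> N MN x Dx /=; rewrite (le_trans (FM x Dx))// ltW.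
Qed.

End BoundedMeasurable.

Lemma bounded_measurable_comp d d' (X : measurableType d)
    (Y : measurableType d') {R : realType} (D : set X) (E : set Y)
    (phi : X -> Y) (F : Y -> R) :
  measurable E -> D `<=` phi @^-1` E -> measurable_fun D phi ->
  bounded_measurable E F -> bounded_measurable D (fun x => F (phi x)).
Proof.
move=> mE DE mphi [mF [M FM]]; split; last by exists M => x /DE; exact: FM.
by apply: (measurable_comp mE) mF mphi => _ [x /DE Ex <-].
Qed.

Lemma continuous_bounded_measurable {R : realType} (a b : R) (g : R -> R) :
  {within `[a, b], continuous g} ->
  @bounded_measurable _ (measurableTypeR R) _ `[a, b] g.
Proof.
move=> cg; split.
  by apply: subspace_continuous_measurable_fun.
have /compact_bounded[M [_ gM]] :=
  continuous_compact cg (@segment_compact _ a b).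
exists (M + 1) => x xab; apply: gM; first by rewrite ltrDl.
by exists x.
Qed.

Lemma Rintegral_sum d (X : measurableType d) {R : realType}
    (m : {measure set X -> \bar R}) (D : set X) I (s : seq I)
    (F : I -> X -> R) :
  measurable D -> (forall i, m.-integrable D (EFin \o F i)) ->
  \int[m]_(x in D) (\sum_(i <- s) F i x) = \sum_(i <- s) \int[m]_(x in D) F i x.
Proof.
move=> mD iF; rewrite /Rintegral; under eq_integral do rewrite -sumEFin.
rewrite (integral_sum mD iF) -sum_fine// => i _.
exact: integrable_fin_num.
Qed.

(** For almost all x the inner integral is finite, which makes it harmless that
    the inner real-valued integral is 0 where the extended-real one is not. *)
Lemma Rintegral_prod d1 d2 (T1 : measurableType d1) (T2 : measurableType d2)
    {R : realType} (m1 : {sigma_finite_measure set T1 -> \bar R})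
    (m2 : {sigma_finite_measure set T2 -> \bar R}) (E : set (T1 * T2))
    (G : T1 * T2 -> R) :
  measurable E -> (m1 \x m2)%E.-integrable E (EFin \o G) ->
  \int[(m1 \x m2)%E]_(p in E) G p =
  \int[m1]_x \int[m2]_(y in xsection E x) G (x, y).
Proof.
move=> mE iG; pose GE := (EFin \o G) \_ E.
have iGE : (m1 \x m2)%E.-integrable setT GE by rewrite -integrable_mkcond.
pose H x := (\int[m2]_(y in xsection E x) (G (x, y))%:E)%E.
have HE : fubini_F m2 GE = H.
  apply/funext => x; rewrite /fubini_F /H [RHS]integral_mkcond.
  apply: eq_integral => y _; rewrite /GE !patchE.
  by rewrite mem_xsection.
rewrite /Rintegral integral_mkcond -integral12_prod_meas1//.
rewrite [X in fine (integral _ _ X)]HE.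
have mH : measurable_fun setT H by rewrite -HE; exact: measurable_fubini_F iGE.
congr fine; apply: ae_eq_integral => //.
  by apply/measurable_EFinP; exact: measurableT_comp.
have := integrable_ae measurableT (integrable_fubini_F iGE).
by rewrite HE; apply: filterS => x /(_ I) Hx _; rewrite fineK.
Qed.

(** * The domain of ordered tuples *)

Section OrderedDomains.
Context {R : realType}.
Variable b : R.
Local Notation T := (measurableTypeR R).

(** The ordered tuples with their lower end as an extra coordinate. This set
    is measurable by induction on n, because the first variable of a tuple is
    the lower end for the remaining ones; its sections are the sets of ordered
    tuples. *)
Definition ordered_tails n : set (T * n.-tuple T) :=
  [set p : T * n.-tuple T | path <%R (p.1 : R) (rcons p.2 b)].

Arguments ordered_tails : clear implicits.

Lemma measurable_lt d (X : measurableType d) (u v : X -> R) :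
  measurable_fun setT u -> measurable_fun setT v ->
  measurable [set x | u x < v x].
Proof.
move=> m_u m_v; rewrite -[X in measurable X]setTI.
exact: (measurable_fun_ltr m_u m_v measurableT (Y := [set true])).
Qed.

Lemma ordered_tails_cons n (p : T * n.+1.-tuple T) :
  ordered_tails n.+1 p <->
  (p.1 : R) < thead p.2 /\ ordered_tails n (uncons_pair p.2).
Proof.
rewrite /ordered_tails/= /uncons_pair/=; case: p => x [[|y s] sn]//=.
by split=> [/andP|[? ?]] //=; apply/andP.
Qed.

Lemma measurable_ordered_tails n : measurable (ordered_tails n).
Proof.
elim: n => [|n IHn].
  rewrite (_ : ordered_tails 0 = [set p | (p.1 : R) < b]).
    by apply: measurable_lt => //; exact: measurable_fst.
  by apply/seteqP; split => -[x y]; rewrite /ordered_tails/= tuple0/= andbT.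
rewrite (_ : ordered_tails n.+1 = [set p | (p.1 : R) < thead p.2] `&`
    (fun p => uncons_pair p.2) @^-1` ordered_tails n); last first.
  by apply/seteqP; split => p /ordered_tails_cons.
apply: measurableI.
  apply: measurable_lt; first exact: measurable_fst.
  by apply: (measurableT_comp (measurable_tnth _)); exact: measurable_snd.
rewrite -[X in measurable X]setTI.
by apply: (measurableT_comp (@measurable_uncons_pair R n) measurable_snd).
Qed.

Lemma ordered_tuplesE n x :
  @ordered_tuples R x b n = xsection (ordered_tails n) x.
Proof. by apply/seteqP; split => s; rewrite /xsection/= inE. Qed.

Lemma measurable_ordered_tuples n x :
  measurable (@ordered_tuples R x b n).
Proof.
rewrite ordered_tuplesE; apply: measurable_xsection.
exact: measurable_ordered_tails.
Qed.

Lemma path_between (x : R) (s : seq R) :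
  path <%R x (rcons s b) -> x < b /\ {in s, forall y, x < y < b}.
Proof.
elim: s x => [|y s IHs] x /=; first by rewrite andbT.
case/andP=> xy /IHs[yb sb]; split; first exact: lt_trans yb.
move=> z; rewrite inE => /predU1P[->|/sb/andP[yz zb]]; first exact/andP.
by rewrite zb (lt_trans xy).
Qed.

Lemma ordered_tuples_between n x (s : n.-tuple T) i :
  @ordered_tuples R x b n s -> `]x, b[%classic (tnth s i).
Proof.
by move=> /path_between[_ /(_ (tnth s i) (mem_tnth i s))]; rewrite /= in_itv.
Qed.

Lemma tuple_lebesgue_ordered_tuples n x :
  (tuple_lebesgue n (@ordered_tuples R x b n) < +oo)%E.
Proof.
pose box := [set s : n.-tuple T | forall i, `]x, b[%classic (tnth s i)].
have mbox : measurable box.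
  rewrite (_ : box = \bigcap_(i in [set: 'I_n])
      ((fun s : n.-tuple T => tnth s i) @^-1` `]x, b[)); last first.
    by apply/seteqP; split=> s bs i; [move=> _; exact: bs|exact: (bs i)].
  apply: fin_bigcap_measurable => [|i _]; first exact: finite_finset.
  by rewrite -[X in measurable X]setTI; exact: measurable_tnth.
apply: (@le_lt_trans _ _ (tuple_lebesgue n box)).
  apply: le_measure; rewrite ?inE//; first exact: measurable_ordered_tuples.
  by move=> s sx i; exact: ordered_tuples_between.
rewrite (@tuple_lebesgue_box R n (fun=> `]x, b[%classic))//.
rewrite lebesgue_measure_itv/=.
case: ifP => _; first by rewrite -EFinB prodEFin ltry.
by case: n {box mbox} => [|n]; rewrite ?big_ord0 ?big_ord_recl ?mul0e ltry.
Qed.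

End OrderedDomains.

(** * Integrating over the smallest variable last *)

Section DetIntegral.
Context {R : realType} {I : Type}.
Variables (a b : R) (f : I -> R -> R).
Hypothesis cf : forall y, {within `[a, b], continuous (f y)}.
Local Notation T := (measurableTypeR R).
Local Notation mu := (@lebesgue_measure R).
Implicit Types h : nat -> I.

Lemma det_cons n h (x : T) (s : n.-tuple T) :
  \det (\matrix_(i < n.+1, j < n.+1) f (h i) (tnth (cons_pair (x, s)) j)) =
  \sum_(j < n.+1) (-1) ^+ j * (f (h j) x *
     \det (\matrix_(i < n, i' < n) f (h (bump j i)) (tnth s i'))).
Proof.
rewrite (expand_det_col _ ord0); apply: eq_bigr => j _.
rewrite mxE /cofactor addn0 mulrCA; congr (_ * (f _ _ * _)).
congr (\det _); apply/matrixP => i i'; rewrite !mxE.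
by congr (f _ _); rewrite tnthS.
Qed.

Lemma Rintegral_cons_measure n
    (nu : {sigma_finite_measure set (n.-tuple T) -> \bar R})
    (D : set (n.+1.-tuple T)) (F : n.+1.-tuple T -> R) :
  measurable D -> (cons_measure nu D < +oo)%E -> bounded_measurable D F ->
  \int[cons_measure nu]_(x in D) F x =
  \int[(mu \x nu)%E]_(p in @cons_pair R n @^-1` D) F (cons_pair p).
Proof.
move=> mD Doo bF.
have mcons := @measurable_cons_pair R n.
have mE : measurable (@cons_pair R n @^-1` D).
  by rewrite -[X in measurable X]setTI; exact: mcons.
(* The change of variables asks for a function measurable everywhere. *)
have FE : {in D, F =1 F \_ D} by move=> x xD; rewrite patchE xD.
rewrite (eq_Rintegral _ FE).
rewrite [RHS](_ : _ = \int[(mu \x nu)%E]_(p in @cons_pair R n @^-1` D)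
    (F \_ D) (cons_pair p)); last first.
  by apply: eq_Rintegral => p; rewrite !inE => Dp; rewrite -FE ?inE.
congr fine; apply: (integral_pushforward mcons (f := EFin \o (F \_ D))) => //.
  by apply/measurable_EFinP; apply/(measurable_restrictT _ mD); case: bF.
apply: (bounded_measurable_integrable mE) => //.
apply: (bounded_measurable_comp (E := D)) => //.
  exact: measurable_funTS.
split; first by apply: (measurable_funS measurableT) => //;
   apply/(measurable_restrictT _ mD); case: bF.
case: bF => _ [M FM]; exists M => x Dx; rewrite -FE ?inE//; exact: FM.
Qed.

Lemma bounded_measurable_det_ordered n h x : a <= x ->
  bounded_measurable (@ordered_tuples R x b n)
    (fun s => \det (\matrix_(i < n, j < n) f (h i) (tnth s j))).
Proof.
move=> ax; apply: bounded_measurable_det => i j.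
apply: (bounded_measurable_comp (E := `[a, b]%classic)) => //.
- move=> s /(ordered_tuples_between j); rewrite /= !in_itv/=.
  by case/andP => xs /ltW ->; rewrite andbT (le_trans ax (ltW xs)).
- by apply: measurable_funTS; exact: measurable_tnth.
- exact: continuous_bounded_measurable.
Qed.

(** Fubini's theorem for R * R^n = R^(n+1): the section of the domain at x_1 = x
    is the domain with lower end x, and the determinant is expanded along the
    column of x_1. *)
Lemma det_integral_cons n h t : a <= t ->
  det_integral t b (fun i : 'I_n.+1 => f (h i)) =
  single_integral t b (fun x => \sum_(j < n.+1) (-1) ^+ j *
    (f (h j) x * det_integral x b (fun i : 'I_n => f (h (bump j i))))).
Proof.
move=> at_; have mD := @measurable_ordered_tuples R b n.+1 t.
have bF := @bounded_measurable_det_ordered n.+1 h t at_.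
have Doo := @tuple_lebesgue_ordered_tuples R b n.+1 t.
pose E := @cons_pair R n @^-1` @ordered_tuples R t b n.+1.
have mcons := @measurable_cons_pair R n.
have mE : measurable E by rewrite -[X in measurable X]setTI; exact: mcons.
rewrite /det_integral [LHS]Rintegral_cons_measure// -/E.
rewrite Rintegral_prod//; last first.
  apply: (bounded_measurable_integrable mE) => //.
  by apply: (bounded_measurable_comp mD _ _ bF) => //; exact: measurable_funTS.
rewrite /single_integral [RHS]Rintegral_mkcond; apply: eq_Rintegral => x _.
have secE s : xsection E x s <-> t < x /\ ordered_tuples x b s.
  by rewrite /xsection/E/= inE /ordered_tuples/=; split=> /andP.
rewrite patchE; case: ifPn => [|/negP xtb]; last first.
  rewrite (_ : xsection E x = set0) ?Rintegral_set0//.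
  rewrite -subset0 => s /secE[tx /path_between[xb _]].
  by apply: xtb; rewrite inE /= in_itv/= tx.
rewrite inE/= in_itv/= => /andP[tx xb].
have -> : xsection E x = @ordered_tuples R x b n.
  by apply/seteqP; split => [s /secE[]//|s xs]; apply/secE.
under eq_Rintegral do rewrite det_cons.
have ax : a <= x := le_trans at_ (ltW tx).
have iF (j : 'I_n.+1) : (tuple_lebesgue n).-integrable (@ordered_tuples R x b n)
    (EFin \o fun s =>
      \det (\matrix_(i < n, i' < n) f (h (bump j i)) (tnth s i'))).
  apply: bounded_measurable_integrable.
  - exact: measurable_ordered_tuples.
  - exact: tuple_lebesgue_ordered_tuples.
  - exact: (@bounded_measurable_det_ordered n (h \o bump j)).
have mO := @measurable_ordered_tuples R b n x.
have iZF (j : 'I_n.+1) c :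
    (tuple_lebesgue n).-integrable (@ordered_tuples R x b n)
    (EFin \o fun s => c *
      \det (\matrix_(i < n, i' < n) f (h (bump j i)) (tnth s i'))).
  exact: (integrableZl mO c (iF j)).
under eq_Rintegral do under eq_bigr do rewrite mulrA.
rewrite Rintegral_sum//; apply: eq_bigr => j _.
by rewrite RintegralZl ?mulrA//; exact: iF.
Qed.

End DetIntegral.

Section IteratedIntegrals.
Context {R : realType} {I : Type}.
Variables (a b : R) (f : I -> R -> R).
Hypothesis cf : forall y, {within `[a, b], continuous (f y)}.
Local Notation T := (measurableTypeR R).
Local Notation mu := (@lebesgue_measure R).

Lemma measurable_ordered_pairs t : measurable (ordered_pairs t b).
Proof.
rewrite (_ : ordered_pairs t b = [set p | t < (p.1 : R)] `&`
    [set p | (p.1 : R) < p.2] `&` [set p | (p.2 : R) < b]); last first.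
  by apply/seteqP; split => p [] //= [].
by apply: measurableI; [apply: measurableI|]; apply: measurable_lt => //;
  (exact: measurable_fst || exact: measurable_snd).
Qed.

Lemma lebesgue_ordered_pairs t : ((mu \x mu)%E (ordered_pairs t b) < +oo)%E.
Proof.
apply: (@le_lt_trans _ _ ((mu \x mu)%E (`[t, b] `*` `[t, b]))).
  apply: le_measure; rewrite ?inE; first exact: measurable_ordered_pairs.
    exact: measurableX.
  move=> p [tp pp pb]; rewrite /= !in_itv/=.
  by split; apply/andP; split; apply/ltW => //;
    [exact: lt_trans pb|exact: lt_trans pp].
rewrite [X in (X < _)%E]product_measure1E//.
have tb_oo : (mu `[t, b] < +oo)%E.
  by rewrite lebesgue_measure_itv/=; case: ifP => _; rewrite ?ltry.
by rewrite lte_mul_pinfty// ge0_fin_numE.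
Qed.

Lemma pair_integral_iterated y z t : a <= t ->
  pair_integral t b (f y) (f z) = single_integral t b (fun x =>
    f y x * single_integral x b (f z) - f z x * single_integral x b (f y)).
Proof.
move=> a_t; have mO := measurable_ordered_pairs t.
have bM1 w : bounded_measurable (ordered_pairs t b) (fun p => f w p.1).
  apply: (bounded_measurable_comp (E := `[a, b]%classic)) => //.
  - move=> p [tp pp pb]; rewrite /= in_itv/= (le_trans a_t (ltW tp)).
    exact/ltW/(lt_trans pp).
  - by apply: measurable_funTS; exact: measurable_fst.
  - exact: continuous_bounded_measurable.
have bM2 w : bounded_measurable (ordered_pairs t b) (fun p => f w p.2).
  apply: (bounded_measurable_comp (E := `[a, b]%classic)) => //.
  - move=> p [tp pp pb]; rewrite /= in_itv/= (ltW pb) andbT.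
    exact/(le_trans a_t)/ltW/(lt_trans tp).
  - by apply: measurable_funTS; exact: measurable_snd.
  - exact: continuous_bounded_measurable.
rewrite /pair_integral [LHS]Rintegral_prod//; last first.
  apply: bounded_measurable_integrable => //.
    exact: lebesgue_ordered_pairs.
  by apply: bounded_measurableB; apply: bounded_measurableM.
rewrite /single_integral [RHS]Rintegral_mkcond; apply: eq_Rintegral => x _.
have secE s : xsection (ordered_pairs t b) x s <-> t < x /\ x < s < b.
  rewrite /xsection/= inE; split => [[/= -> xs sb]|[tx /andP[xs sb]]] //.
  by split => //; apply/andP.
rewrite patchE; case: ifPn => [|/negP xtb]; last first.
  rewrite (_ : xsection _ x = set0) ?Rintegral_set0//.
  rewrite -subset0 => s /secE[tx /andP[xs sb]].
  by apply: xtb; rewrite inE /= in_itv/= tx (lt_trans xs).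
rewrite inE/= in_itv/= => /andP[tx xb].
have -> : xsection (ordered_pairs t b) x = `]x, b[%classic.
  apply/seteqP; split => s; rewrite /= in_itv/=; first by case/secE.
  by move=> xsb; apply/secE.
have i_f w : mu.-integrable `]x, b[ (EFin \o f w).
  apply: integrableS (within_itv_integrable (@cf w)) => //.
  by apply: subset_itv; rewrite bnd_simp// ltW// (le_lt_trans a_t).
have mxb : measurable (`]x, b[%classic : set T) by [].
have iZ c w : mu.-integrable `]x, b[ (EFin \o fun s => c * f w s).
  exact: (integrableZl mxb c (i_f w)).
by rewrite /= (RintegralB mxb (iZ _ z) (iZ _ y)) !RintegralZl.
Qed.

(** The strict bound t < b matters for n = 0, where the domain consists of the
    empty tuple if t < b and is empty otherwise. *)
Lemma det_integral_iterated n (h : nat -> I) t : a <= t < b ->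
  det_integral t b (fun i : 'I_n => f (h i)) = ordered_det b f (mkseq h n) t.
Proof.
elim: n h t => [|n IHn] h t /andP[a_t t_b].
  rewrite /det_integral; under eq_Rintegral do rewrite det_mx00.
  rewrite Rintegral_cst; last exact: measurable_ordered_tuples.
  rewrite [X in fine X](_ : _ = 1%E) ?mulr1//.
  transitivity ((\1_(@ordered_tuples R t b 0) [tuple])%:E : \bar R) => //.
  rewrite indicE mem_set//.
  by rewrite /ordered_tuples/= t_b.
rewrite (det_integral_cons cf)// ordered_detE ?size_mkseq//.
apply: eq_Rintegral => x; rewrite inE/= in_itv/= => /andP[tx xb].
rewrite /ordered_det_integrand altsum_mkseq; apply: eq_bigr => j _.
by rewrite (IHn (h \o bump j))// xb (le_trans a_t (ltW tx)).
Qed.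

End IteratedIntegrals.

Theorem mainTheorem2 (R : realType) (k : nat) (a b : R) (f : 'I_k -> R -> R)
    (k_gt0 : (0 < k)%N) (ab : a < b)
    (cf : forall i : 'I_k, {within `[a, b], continuous (f i)}) :
  (~~ odd k -> det_integral a b f = Pf (pair_integral_mx a b f)) /\
  (odd k -> det_integral a b f = Pf (bordered_integral_mx a b f)).
Proof.
(* The indices as values of a function on nat, as required to delete by bump. *)
pose h := insubd (Ordinal k_gt0).
have hE (i : 'I_k) : h i = i by exact: valKd.
have aab : a \in `[a, b] by rewrite in_itv/= lexx ltW.
have -> : det_integral a b f = ordered_det b f (mkseq h k) a.
  rewrite -(det_integral_iterated cf) ?lexx//; congr det_integral.
  by apply/funext => i; rewrite hE.
have pairE : pair_integral_mx a b f = \matrix_(i < k, j < k)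
    single_integral a b (fun x => f (h i) x * single_integral x b (f (h j)) -
                                  f (h j) x * single_integral x b (f (h i))).
  by apply/matrixP => i j; rewrite !mxE !hE (pair_integral_iterated cf).
split => k_parity; first by rewrite pairE (Pf_iterated_pair_integral ab cf).
rewrite /bordered_integral_mx pairE -(Pf_bordered_iterated_integral ab cf)//.
by congr (Pf (block_mx _ _ _ _)); apply/matrixP => i j; rewrite !mxE hE.
Qed.
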